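(* For all $m\in\mathbb{N}$, $\delta\in(0,1)$ and $\boldsymbol{\mu}\in\Delta_\mathbb{N}$, if $\boldsymbol{X}=(X_1,\dots,X_m)\sim\boldsymbol{\mu}^m$ and $\widehat{\boldsymbol{\mu}}_m$ is the empirical measure of $\boldsymbol{X}$, then with probability at least $1-\delta$, $$\|\widehat{\boldsymbol{\mu}}_m-\boldsymbol{\mu}\|_{TV}\le \Phi_m(\widehat{\boldsymbol{\mu}}_m)+3\sqrt{\frac{\log(2/\delta)}{2m}}.$$ Moreover, $\mathbb{E}\,\|\widehat{\boldsymbol{\mu}}_m-\boldsymbol{\mu}\|_{TV}\le \mathbb{E}\,\Phi_m(\widehat{\boldsymbol{\mu}}_m)$.
   Context: $\mathbb{N}=\{1,2,3,\dots\}$. $\Delta_\mathbb{N}$ is the set of probability distributions on $\mathbb{N}$, viewed as sequences $\boldsymbol{\mu}\in[0,1]^\mathbb{N}$ with $\sum_i\boldsymbol{\mu}(i)=1$. For $\boldsymbol{X}=(X_1,\dots,X_m)$ drawn i.i.d. from $\boldsymbol{\mu}$, the empirical measure is $\widehat{\boldsymbol{\mu}}_m(i)=\frac1m\sum_{t=1}^m\mathbb{I}\{X_t=i\}$. Total variation: $\|\boldsymbol{\mu}-\boldsymbol{\nu}\|_{TV}=\frac12\sum_{i\in\mathbb{N}}|\boldsymbol{\mu}(i)-\boldsymbol{\nu}(i)|$. The half-norm is $\|\boldsymbol{\mu}\|_{1/2}=\left(\sum_{i}\sqrt{\boldsymbol{\mu}(i)}\right)^2$ (possibly infinite). $\Phi_m(\widehat{\boldsymbol{\mu}}_m):=\frac{1}{\sqrt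 m}\|\widehat{\boldsymbol{\mu}}_m\|_{1/2}^{1/2}=\frac1{\sqrt m}\sum_{j\in\mathbb{N}}\sqrt{\widehat{\boldsymbol{\mu}}_m(j)}$. $\log$ is the natural logarithm. *)

(* Defs.v *)
From mathcomp Require Import all_boot all_order all_algebra.
From mathcomp Require Import all_classical all_reals all_analysis.
Set Implicit Arguments. Unset Strict Implicit. Unset Printing Implicit Defensive.
Import Order.TTheory GRing.Theory Num.Theory.
Local Open Scope classical_set_scope.
Local Open Scope ring_scope.

(* The index set N = {1,2,...} is represented by Rocq's nat = {0,1,...}
   (shift by one; the statement is invariant under relabelling). *)

Definition is_distr (R : realType) (mu : nat -> R) : Prop :=
  (forall i, 0 <= mu i) /\ (\esum_(i in [set: nat]) (mu i)%:E = 1%E).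

Definition prod_mass (R : realType) (m : nat) (mu : nat -> R) (x : 'I_m -> nat) : R :=
  \prod_(t < m) mu (x t).

Definition Prob (R : realType) (m : nat) (mu : nat -> R) (A : set ('I_m -> nat)) : \bar R :=
  \esum_(x in A) (prod_mass mu x)%:E.

Definition Expect (R : realType) (m : nat) (mu : nat -> R) (f : ('I_m -> nat) -> \bar R) : \bar R :=
  \esum_(x in [set: 'I_m -> nat]) ((prod_mass mu x)%:E * f x)%E.

Definition emp (R : realType) (m : nat) (x : 'I_m -> nat) (i : nat) : R :=
  (\sum_(t < m) (x t == i)%:R) / m%:R.

Definition tv (R : realType) (mu nu : nat -> R) : \bar R :=
  ((2^-1)%:E * \esum_(i in [set: nat]) (`|mu i - nu i|)%:E)%E.

Definition Phi (R : realType) (m : nat) (nu : nat -> R) : \bar R :=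
  (((Num.sqrt m%:R)^-1)%:E * \esum_(j in [set: nat]) (Num.sqrt (nu j))%:E)%E.

Arguments emp {R m} x i.
Arguments Phi {R} m nu.

(* Main.v *)
(* For each atom [j] the count [N] is binomial with mean [l = m mu(j)], and
   [E |N - l| <= 2 E (sqrt N)]: summed over [j], this bounds the expectation of
   the total variation by that of [Phi].
   Changing one observation moves both [tv] and [Phi] by at most [1 / m], so
   that [F = t m (tv + 1 - Phi)] has differences at most [2 t], where
   [2 m t ^ 2 = ln (2 / delta)]. For [t < 1 / 3] the martingale argument of
   McDiarmid, with [expR y <= 1 + y + y ^ 2] in place of Hoeffding's lemma,
   gives [E (expR F) <= expR (E F + m t ^ 2)], where [E F <= t m]. Markov's
   inequality then bounds the probability of [tv > Phi + 3 t] by [delta / 2].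
   For [t >= 1 / 3] the bound is trivial since [tv <= 1]. *)
Require Import Defs.
From mathcomp Require Import all_boot all_order all_algebra.
From mathcomp Require Import all_classical all_reals all_analysis.
From mathcomp Require Import ring lra.

Set Implicit Arguments.
Unset Strict Implicit.
Unset Printing Implicit Defensive.
Import Order.TTheory GRing.Theory Num.Theory.
Local Open Scope classical_set_scope.
Local Open Scope ring_scope.

(** * Sums of extended reals and means with respect to a weight *)

Lemma esumZl (R : realType) (T : choiceType) (r : R) (f : T -> \bar R) :
  0 <= r -> (forall x, (0 <= f x)%E) ->
  (\esum_(x in [set: T]) (r%:E * f x) = r%:E * \esum_(x in [set: T]) f x)%E.
Proof.
move=> r0 f0; rewrite /esum -ereal_supZl//; last first.
  by apply/set0P; exists (\sum_(x \in set0) f x); exists set0 => //; exact: fsets_set0.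
congr (ereal_sup _); apply/seteqP; split => [_ [A fA <-]|_ [_ [A fA <-] <-]] /=.
  by exists (\sum_(x \in A) f x); [exists A|rewrite ge0_mule_fsumr].
by exists A => //; rewrite ge0_mule_fsumr.
Qed.

Lemma exchange_esum (R : realType) (T U : choiceType) (f : T -> U -> \bar R) :
  (forall x y, (0 <= f x y)%E) ->
  \esum_(x in [set: T]) \esum_(y in [set: U]) f x y =
  \esum_(y in [set: U]) \esum_(x in [set: T]) f x y.
Proof.
move=> f0; rewrite !esum_esum//.
rewrite (reindex_esum ([set: U] `*`` fun=> [set: T]) _ (fun z => (z.2, z.1)))//.
split => //= [[a b] [c d] _ _ [-> ->]//|[a b] _].
by exists (b, a).
Qed.

(** [is_distr] over an arbitrary index type, so that the same lemmas serve [mu] on [nat] and the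
    product mass on tuples. At [nat] the two are convertible. *)
Definition is_weight (R : realType) (T : choiceType) (w : T -> R) : Prop :=
  (forall x, 0 <= w x) /\ \esum_(x in [set: T]) (w x)%:E = 1%E.

Lemma weight_inhabited (R : realType) (T : choiceType) (w : T -> R) :
  is_weight w -> exists x : T, True.
Proof.
move=> [_ w1]; apply: contrapT => /forallNP T0.
move: w1; rewrite esum1 => [|x _]; last by case: (T0 x).
by move=> /eqP; rewrite lt_eqF.
Qed.

(** [Expect mu] is the case [w := prod_mass mu]. Since [\esum] is a supremum of finite sums,
    additivity is available for nonnegative functions only; hence the sign hypotheses throughout. *)
Definition mean (R : realType) (T : choiceType) (w : T -> R) (f : T -> \bar R) :
    \bar R :=
  \esum_(x in [set: T]) ((w x)%:E * f x)%E.

Lemma le_mean (R : realType) (T : choiceType) (w : T -> R) (f g : T -> \bar R) :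
  is_weight w -> (forall x, (f x <= g x)%E) -> (mean w f <= mean w g)%E.
Proof.
by move=> [w0 _] fg; apply: le_esum => x _; rewrite lee_wpmul2l// lee_fin.
Qed.

Lemma eq_mean (R : realType) (T : choiceType) (w : T -> R) (f g : T -> \bar R) :
  f =1 g -> mean w f = mean w g.
Proof. by move=> fg; apply: eq_esum => x _; rewrite fg. Qed.

Lemma meanD (R : realType) (T : choiceType) (w : T -> R) (f g : T -> \bar R) :
  is_weight w -> (forall x, (0 <= f x)%E) -> (forall x, (0 <= g x)%E) ->
  mean w (fun x => f x + g x)%E = (mean w f + mean w g)%E.
Proof.
move=> [w0 _] f0 g0; rewrite /mean -esumD.
- by apply: eq_esum => x _; rewrite ge0_muleDr.
- by move=> x _; rewrite mule_ge0// lee_fin.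
- by move=> x _; rewrite mule_ge0// lee_fin.
Qed.

Lemma meanZl (R : realType) (T : choiceType) (w : T -> R) (r : R)
    (f : T -> \bar R) :
  is_weight w -> 0 <= r -> (forall x, (0 <= f x)%E) ->
  mean w (fun x => r%:E * f x)%E = (r%:E * mean w f)%E.
Proof.
move=> [w0 _] r0 f0; rewrite /mean -esumZl//; first by apply: eq_esum => x _; rewrite muleCA.
by move=> x; rewrite mule_ge0// lee_fin.
Qed.

Lemma mean_cst (R : realType) (T : choiceType) (w : T -> R) (r : R) :
  is_weight w -> 0 <= r -> mean w (fun=> r%:E) = r%:E.
Proof.
move=> [w0 w1] r0; rewrite /mean -[RHS]mule1 -w1 -esumZl//.
by apply: eq_esum => x _; rewrite muleC.
Qed.

Lemma mean_esum (R : realType) (T U : choiceType) (w : T -> R)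
    (f : T -> U -> \bar R) :
  is_weight w -> (forall x y, (0 <= f x y)%E) ->
  mean w (fun x => \esum_(y in [set: U]) f x y) =
  \esum_(y in [set: U]) mean w (f^~ y).
Proof.
move=> [w0 _] f0; rewrite /mean -exchange_esum; last first.
  by move=> x y; rewrite mule_ge0// lee_fin.
by apply: eq_esum => x _; rewrite esumZl.
Qed.

Lemma mean_bounded (R : realType) (T : choiceType) (w : T -> R) (f : T -> R)
    (a b : R) :
  is_weight w -> 0 <= a -> (forall x, a <= f x <= b) ->
  mean w (EFin \o f) \is a fin_num /\ a <= fine (mean w (EFin \o f)) <= b.
Proof.
move=> wP a0 fab.
have f0 x : 0 <= f x by have /andP[+ _] := fab x; exact: le_trans.
have leb : (mean w (EFin \o f) <= b%:E)%E.
  rewrite -(@mean_cst _ _ w b)//.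
    by apply: le_mean => // x; rewrite lee_fin; have /andP[] := fab x.
  have [x _] := weight_inhabited wP.
  by apply: le_trans (f0 x) _; have /andP[] := fab x.
have lea : (a%:E <= mean w (EFin \o f))%E.
  rewrite -(@mean_cst _ _ w a)//.
  by apply: le_mean => // x; rewrite lee_fin; have /andP[] := fab x.
have fin : mean w (EFin \o f) \is a fin_num.
  by rewrite fin_numElt (lt_le_trans _ lea) ?ltNyr// (le_lt_trans leb) ?ltry.
by split => //; rewrite -!lee_fin fineK// lea leb.
Qed.

(* The coefficients may be negative whereas [mean] is additive on nonnegative
   functions only, hence the shift by [`|a| + `|b|]. *)
Lemma mean_le_affine (R : realType) (T : choiceType) (w : T -> R) (f g : T -> R)
    (a b : R) :
  is_weight w -> (forall x, 0 <= f x) -> (forall x, 0 <= g x) ->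
  mean w (EFin \o f) \is a fin_num -> (forall x, g x <= a + b * f x) ->
  (mean w (EFin \o g) <= (a + b * fine (mean w (EFin \o f)))%:E)%E.
Proof.
move=> wP f0 g0 finf gle; set K := `|a| + `|b|.
have K0 : 0 <= K by rewrite addr_ge0.
have aK : 0 <= a + K.
  by rewrite /K; have := ler_norm (- a); rewrite normrN; have := normr_ge0 b; lra.
have bK : 0 <= b + K.
  by rewrite /K; have := ler_norm (- b); rewrite normrN; have := normr_ge0 a; lra.
set M := fine _.
have L : mean w (fun x => (g x)%:E + (K%:E + K%:E * (f x)%:E))%E =
    (mean w (EFin \o g) + (K + K * M)%:E)%E.
  rewrite meanD//; first rewrite meanD// ?mean_cst ?meanZl ?EFinD ?EFinM ?fineK//.
    by move=> x; rewrite -EFinM lee_fin mulr_ge0.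
  by move=> x; rewrite -EFinM -EFinD lee_fin addr_ge0// mulr_ge0.
have U : mean w (fun x => (a + K)%:E + (b + K)%:E * (f x)%:E)%E =
    (a + K + (b + K) * M)%:E.
  rewrite meanD// => [|x]; last by rewrite -EFinM lee_fin mulr_ge0.
  by rewrite mean_cst ?meanZl ?EFinD ?EFinM ?fineK.
have : (mean w (EFin \o g) + (K + K * M)%:E <= (a + K + (b + K) * M)%:E)%E.
  rewrite -L -U; apply: le_mean => // x.
  by rewrite -!EFinM -!EFinD lee_fin; have := gle x; lra.
rewrite -leeBrDr// -EFinB; congr (_ <= _)%E; congr EFin; lra.
Qed.

(** * Product mass on tuples, splitting off the first observation *)

Definition cons_fun (m : nat) (i : nat) (x : 'I_m -> nat) : 'I_m.+1 -> nat :=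
  fun t => oapp x i (unlift ord0 t).

Lemma cons_fun0 m i (x : 'I_m -> nat) : cons_fun i x ord0 = i.
Proof. by rewrite /cons_fun unlift_none. Qed.

Lemma cons_fun_lift m i (x : 'I_m -> nat) t : cons_fun i x (lift ord0 t) = x t.
Proof. by rewrite /cons_fun liftK. Qed.

Lemma prod_mass_cons (R : realType) m (mu : nat -> R) i (x : 'I_m -> nat) :
  prod_mass mu (cons_fun i x) = mu i * prod_mass mu x.
Proof.
rewrite /prod_mass big_ord_recl cons_fun0; congr (_ * _).
by apply: eq_bigr => t _; rewrite cons_fun_lift.
Qed.

Lemma prod_mass_ge0 (R : realType) m (mu : nat -> R) (x : 'I_m -> nat) :
  (forall i, 0 <= mu i) -> 0 <= prod_mass mu x.
Proof. by move=> mu0; apply: prodr_ge0. Qed.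

Lemma mean_prod_mass0 (R : realType) (mu : nat -> R) (f : ('I_0 -> nat) -> \bar R) x :
  (forall y, 0 <= f y)%E -> mean (prod_mass mu) f = f x.
Proof.
move=> f0.
have all_eq (y : 'I_0 -> nat) : y = x by apply: funext => -[].
rewrite /mean (_ : [set: 'I_0 -> nat] = [set x]); last first.
  by apply/seteqP; split => y // _; apply: all_eq.
by rewrite esum_set1 /prod_mass big_ord0 mul1e.
Qed.

(** Tonelli along the bijection [(i, x) |-> cons_fun i x]. Every induction on the sample size below
    conditions on the first observation in this way. *)
Lemma mean_prod_massS (R : realType) m (mu : nat -> R)
    (f : ('I_m.+1 -> nat) -> \bar R) :
  is_weight mu -> (forall x, (0 <= f x)%E) ->
  mean (prod_mass mu) f =
  mean mu (fun i => mean (prod_mass mu) (fun x => f (cons_fun i x))).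
Proof.
move=> [mu0 _] f0; rewrite /mean.
transitivity (\esum_(i in [set: nat]) \esum_(x in [set: 'I_m -> nat])
    ((mu i * prod_mass mu x)%:E * f (cons_fun i x))%E); last first.
  apply: eq_esum => i _; rewrite -esumZl//.
    by apply: eq_esum => x _; rewrite EFinM muleA.
  by move=> x; rewrite mule_ge0// lee_fin prod_mass_ge0.
rewrite esum_esum => [|i x _ _]; last first.
  by rewrite mule_ge0// lee_fin mulr_ge0// prod_mass_ge0.
rewrite (reindex_esum ([set: nat] `*`` fun=> [set: 'I_m -> nat]) _
  (fun z => cons_fun z.1 z.2)); last first.
  split => // [[i x] [j y] _ _ /= e|y _].
    congr pair; first by rewrite -(cons_fun0 i x) e cons_fun0.
    by apply: funext => t; rewrite -(cons_fun_lift i) e cons_fun_lift.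
  exists (y ord0, y \o lift ord0) => //=; apply: funext => t.
  by case: (unliftP ord0 t) => [s ->|->]; rewrite ?cons_fun_lift ?cons_fun0.
by apply: eq_esum => -[i x] _; rewrite prod_mass_cons.
Qed.

Lemma is_weight_prod_mass (R : realType) m (mu : nat -> R) :
  is_weight mu -> is_weight (@prod_mass R m mu).
Proof.
move=> muP; have [mu0 mu1] := muP; split => [x|]; first exact: prod_mass_ge0.
suff : mean (@prod_mass R m mu) (fun=> 1%:E) = 1%E.
  by move=> <-; apply: eq_esum => x _; rewrite mule1.
elim: m => [|m IH]; first by rewrite (mean_prod_mass0 mu (fun=> 0%N)).
rewrite mean_prod_massS//.
under [X in mean mu X]funext => i do rewrite IH.
exact: mean_cst.
Qed.

(** * Exponential moments under bounded differences *)

(** From [1 - y / 4 <= expR (- (y / 4))], raised to the fourth power, [expR y <= q ^- 4] with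
    [q = 1 - y / 4]. It remains to see that [(1 + y + y ^+ 2) * q ^+ 4 >= 1], a polynomial
    inequality in [q] on [q >= 5 / 6]. *)
Lemma expR_le_quadratic (R : realType) (y : R) :
  y <= 2 / 3 -> expR y <= 1 + y + y ^+ 2.
Proof.
move=> y23; set q := 1 - y / 4.
have q56 : 5 / 6 <= q by rewrite /q; lra.
have ey : expR y * expR (- (y / 4)) ^+ 4 = 1.
  by rewrite -expRM_natl -expRD (_ : _ + _ = 0) ?expR0//; lra.
have qe : q <= expR (- (y / 4)) by have := expR_ge1Dx (- (y / 4)).
have q0 : 0 <= q by lra.
have e0 := expR_gt0 y.
have le1 : expR y * q ^+ 4 <= 1.
  by rewrite -ey ler_pM2l// lerXn2r// nnegrE ?expR_ge0.
have ge1 : 1 <= (1 + y + y ^+ 2) * q ^+ 4.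
  have -> : y = 4 - 4 * q by rewrite /q; lra.
  rewrite -subr_ge0.
  (* The difference has a double root at [q = 1], that is [y = 0]. Its cofactor, expanded around
     [5 / 6], has nonnegative coefficients only. *)
  have -> : (1 + (4 - 4 * q) + (4 - 4 * q) ^+ 2) * q ^+ 4 - 1 =
    (q - 1) ^+ 2 * (16 * q ^+ 4 - 4 * q ^+ 3 - 3 * q ^+ 2 - 2 * q - 1) by ring.
  rewrite mulr_ge0 ?sqr_ge0//.
  have [s -> s0] : exists2 s, q = 5 / 6 + s & 0 <= s by exists (q - 5 / 6); lra.
  have s2 : 0 <= s ^+ 2 by exact: exprn_ge0.
  have s3 : 0 <= s ^+ 3 by exact: exprn_ge0.
  have s4 : 0 <= s ^+ 4 by exact: exprn_ge0.
  lra.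
have q4 : 0 < q ^+ 4 by rewrite exprn_gt0//; lra.
by rewrite -(ler_pM2r q4) (le_trans le1).
Qed.

(* The variance of a variable ranging in an interval [[a, a + c]] is at most
   [(M - a) (a + c - M) <= c ^ 2 / 4], where [M] is its mean. *)
Lemma mean_expR_le (R : realType) (T : choiceType) (w : T -> R) (h : T -> R)
    (c C : R) :
  is_weight w -> c <= 2 / 3 -> (forall x, 0 <= h x <= C) ->
  (forall x y, h x - h y <= c) ->
  (mean w (EFin \o (expR \o h)) <=
   (expR (fine (mean w (EFin \o h)) + c ^+ 2 / 4))%:E)%E.
Proof.
move=> wP c23 hC hc.
have h0 x : 0 <= h x by case/andP: (hC x).
have [x0 _] := weight_inhabited wP.
set a := inf (range h).
have rh : range h !=set0 by exists (h x0); exists x0.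
have ah x : a <= h x.
  by apply: ge_inf; [exists 0 => _ [y _ <-] | exists x].
have a0 : 0 <= a by apply: lb_le_inf => // _ [y _ <-].
have hac x : h x <= a + c.
  by rewrite -lerBlDr; apply: lb_le_inf => // _ [y _ <-]; have := hc x y; lra.
have [fin /andP[aM Mac]] : mean w (EFin \o h) \is a fin_num /\
    a <= fine (mean w (EFin \o h)) <= a + c.
  by apply: mean_bounded => // x; rewrite ah hac.
set M := fine _ in aM Mac *.
(* The coefficients come from [expR (h - M) <= 1 + (h - M) + (h - M) ^+ 2], where [h ^+ 2] is
   replaced by its chord [(2 * a + c) * h - a * (a + c)] over [[a, a + c]]; the bound becomes affine
   in [h]. *)
apply: (le_trans (mean_le_affine (a := expR M * (1 - M - a * (a + c) + M ^+ 2))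
  (b := expR M * (1 + 2 * a + c - 2 * M)) wP h0 _ fin _)) => [x|x|].
- exact: expR_ge0.
- have -> : (expR \o h) x = expR M * expR (h x - M) by rewrite -expRD/=; congr expR; lra.
  rewrite -mulrA -mulrDr ler_pM2l ?expR_gt0//.
  have := ah x; have := hac x => hx1 hx2.
  apply: le_trans (expR_le_quadratic _) _; first by lra.
  have : 0 <= (h x - a) * (a + c - h x) by rewrite mulr_ge0; lra.
  lra.
(* At [h = M] the affine bound equals [expR M * (1 + (M - a) * (a + c - M))], and
   [1 + c ^+ 2 / 4 <= expR (c ^+ 2 / 4)]. *)
- rewrite lee_fin -/M expRD -mulrA -mulrDr ler_pM2l ?expR_gt0//.
  apply: le_trans (expR_ge1Dx _).
  have : 0 <= (M - a - c / 2) ^+ 2 by exact: sqr_ge0.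
  lra.
Qed.

(** Given the first observation [i], the induction hypothesis handles the others and leaves
    [expR (h i)], with [h i] the conditional mean. As [h] also varies by at most [c], [mean_expR_le]
    adds one more [c ^+ 2 / 4]. *)
Lemma mean_expR_bounded_diff (R : realType) m (mu : nat -> R)
    (f : ('I_m -> nat) -> R) (c C : R) :
  is_weight mu -> c <= 2 / 3 -> (forall x, 0 <= f x <= C) ->
  (forall k x y, (forall t, t != k -> x t = y t) -> f x - f y <= c) ->
  (mean (prod_mass mu) (EFin \o (expR \o f)) <=
   (expR (fine (mean (prod_mass mu) (EFin \o f)) + m%:R * (c ^+ 2 / 4)))%:E)%E.
Proof.
move=> muP c23; elim: m f => [|m IH] f fC fc.
  pose x0 : 'I_0 -> nat := fun=> 0.
  have f0 x : 0 <= f x by case/andP: (fC x).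
  rewrite !(mean_prod_mass0 mu x0) => [|y|y]; last 2 first.
  - by rewrite lee_fin.
  - by rewrite lee_fin expR_ge0.
  by rewrite /= mul0r addr0.
have f0 x : 0 <= f x by case/andP: (fC x).
have C0 : 0 <= C by case/andP: (fC (fun=> 0%N)) => /le_trans; apply.
have wP := is_weight_prod_mass m muP.
pose fi i x := f (cons_fun i x).
pose h i := fine (mean (prod_mass mu) (EFin \o fi i)).
have hb i : mean (prod_mass mu) (EFin \o fi i) \is a fin_num /\ 0 <= h i <= C.
  by apply: mean_bounded => // x; apply: fC.
(* [fi i] and [fi j] evaluate [f] at tuples that differ only at [ord0], so they are within [c]
   pointwise; an affine comparison of slope 1 passes this to the means. *)
have hc i j : h i - h j <= c.
  have [fini _] := hb i; have [finj _] := hb j.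
  have := mean_le_affine (a := c) (b := 1) (g := fi i) wP (fun x => f0 _)
    (fun x => f0 _) finj.
  rewrite -(fineK fini) lee_fin -/(h i) -/(h j) => H.
  suff : h i <= c + 1 * h j by lra.
  apply: H => x; rewrite mul1r -lerBlDr; apply: (fc ord0) => t.
  by case: (unliftP ord0 t) => [s -> _|->]; rewrite ?cons_fun_lift ?eqxx.
have meanf : mean (prod_mass mu) (EFin \o f) = mean mu (EFin \o h).
  rewrite mean_prod_massS//.
  by apply: eq_mean => i /=; have [fini _] := hb i; rewrite fineK.
set K := m%:R * (c ^+ 2 / 4).
rewrite mean_prod_massS//; last by move=> x; rewrite lee_fin expR_ge0.
have step i : (mean (prod_mass mu) (fun x => (EFin \o (expR \o f)) (cons_fun i x)) <=
    (expR K)%:E * (expR (h i))%:E)%E.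
  rewrite -EFinM -expRD addrC; apply: IH => [x|k x y xy]; first exact: fC.
  apply: (fc (lift ord0 k)) => t; case: (unliftP ord0 t) => [s ->|->].
    by rewrite (inj_eq lift_inj) !cons_fun_lift; apply: xy.
  by rewrite !cons_fun0.
apply: le_trans (le_mean muP step) _.
rewrite meanZl ?expR_ge0//.
apply: (le_trans (lee_wpmul2l _ (mean_expR_le muP c23 (fun i => (hb i).2) hc))).
  by rewrite lee_fin expR_ge0.
rewrite -EFinM -expRD lee_fin meanf ler_expR /K -natr1.
lra.
Qed.

(** * The count of an atom and the binomial distribution *)

Lemma mean_pred1 (R : realType) (T : choiceType) (w : T -> R) (j : T) :
  is_weight w -> mean w (fun i => (i == j)%:R%:E) = (w j)%:E.
Proof.
move=> [w0 _].
have -> : (w j)%:E = \esum_(i in [set j]) (w i)%:E by rewrite esum_set1// lee_fin.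
rewrite esum_mkcond; apply: eq_esum => i _ /=.
have [->|ij] := eqVneq i j; first by rewrite mem_set// mule1.
by rewrite mule0 memNset// => /eqP; rewrite (negbTE ij).
Qed.

Lemma weight_le1 (R : realType) (T : choiceType) (w : T -> R) (j : T) :
  is_weight w -> w j <= 1.
Proof.
move=> wP; rewrite -lee_fin -mean_pred1// -(mean_cst wP ler01).
by apply: le_mean => // i; rewrite lee_fin; case: eqP; rewrite ?ler01.
Qed.

Lemma mean_if_eq (R : realType) (T : choiceType) (w : T -> R) (j : T) (a b : R) :
  is_weight w -> 0 <= a -> 0 <= b ->
  mean w (fun i => (if i == j then a else b)%:E) = (w j * a + (1 - w j) * b)%:E.
Proof.
move=> wP a0 b0.
have ind0 i : (0 <= (i == j)%:R%:E :> \bar R)%E by rewrite lee_fin ler0n.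
have g0 i : (0 <= (if i == j then a else b)%:E)%E by rewrite lee_fin; case: ifP.
(* The term [b * w j] is added on both sides to avoid a subtraction: pointwise, the conditional plus
   [b * (i == j)] is [b + a * (i == j)]. *)
have : (mean w (fun i => (if i == j then a else b)%:E) + (b * w j)%:E =
    b%:E + (a * w j)%:E)%E.
  rewrite !EFinM -(mean_pred1 j wP) -!meanZl// -[X in (X + _)%E = _]/(mean w _).
  rewrite -{2}(mean_cst wP b0) -!meanD//.
  - by apply: eq_mean => i; case: eqP => _; rewrite ?mule1 ?mule0 ?adde0 1?addeC.
  - by move=> i; rewrite mule_ge0.
  - by move=> i; rewrite mule_ge0.
move=> /(congr1 (fun z => z - (b * w j)%:E)%E); rewrite addeK// => ->.
rewrite -EFinD; congr EFin; lra.
Qed.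

Definition occ (m : nat) (x : 'I_m -> nat) (j : nat) : nat :=
  (\sum_(t < m) (x t == j))%N.

Lemma occ_cons m i (x : 'I_m -> nat) j : occ (cons_fun i x) j = ((i == j) + occ x j)%N.
Proof.
rewrite /occ big_ord_recl cons_fun0; congr (_ + _)%N.
by apply: eq_bigr => t _; rewrite cons_fun_lift.
Qed.

(* The expectation of [h] under the binomial distribution. *)
Fixpoint binE (R : realType) (p : R) (n : nat) (h : nat -> R) : R :=
  if n is n'.+1 then p * binE p n' (h \o succn) + (1 - p) * binE p n' h else h 0%N.

Lemma binE_ge0 (R : realType) (p : R) n (h : nat -> R) :
  0 <= p <= 1 -> (forall k, 0 <= h k) -> 0 <= binE p n h.
Proof.
case/andP=> p0 p1; elim: n h => [|n IH] h h0 //=.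
by rewrite addr_ge0// mulr_ge0 ?subr_ge0// IH//= => k; apply: h0.
Qed.

Lemma le_binE (R : realType) (p : R) n (g h : nat -> R) :
  0 <= p <= 1 -> (forall k, g k <= h k) -> binE p n g <= binE p n h.
Proof.
case/andP=> p0 p1; elim: n g h => [|n IH] g h gh //=.
by rewrite lerD// ler_wpM2l ?subr_ge0// IH//= => k; apply: gh.
Qed.

Lemma eq_binE (R : realType) (p : R) n (g h : nat -> R) : g =1 h -> binE p n g = binE p n h.
Proof. by move=> /funext ->. Qed.

Lemma binED (R : realType) (p : R) n (g h : nat -> R) :
  binE p n (fun k => g k + h k) = binE p n g + binE p n h.
Proof.
elim: n g h => [|n IH] g h //=.
by rewrite (IH (g \o succn) (h \o succn)) IH; lra.
Qed.

Lemma binEZ (R : realType) (p : R) n a (h : nat -> R) :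
  binE p n (fun k => a * h k) = a * binE p n h.
Proof. by elim: n h => [|n IH] h //=; rewrite (IH (h \o succn)) IH; lra. Qed.

Lemma binE_cst (R : realType) (p : R) n a : binE p n (fun=> a) = a.
Proof.
elim: n => [|n IH] //=; have -> : binE p n ((fun=> a) \o succn) = a by [].
by rewrite ?IH; lra.
Qed.

Lemma binE_id (R : realType) (p : R) n : binE p n (fun k => k%:R) = n%:R * p.
Proof.
elim: n => [|n IH] /=; first by rewrite mul0r.
rewrite (@eq_binE _ p n _ (fun k => k%:R + 1)) => [|k]; last by rewrite /= -natr1.
rewrite binED binE_cst IH -natr1.
lra.
Qed.

Lemma binE_sqr (R : realType) (p : R) n :
  binE p n (fun k => k%:R ^+ 2) = (n%:R * p) ^+ 2 + n%:R * p * (1 - p).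
Proof.
elim: n => [|n IH] /=; first by rewrite !mul0r expr0n/= addr0.
rewrite (@eq_binE _ p n _ (fun k => k%:R ^+ 2 + (2 * k%:R + 1))); last first.
  by move=> k /=; rewrite -natr1; ring.
by rewrite !binED binEZ binE_cst binE_id IH -natr1; ring.
Qed.

Lemma binE_eq0 (R : realType) (p : R) n :
  binE p n (fun k => (k == 0%N)%:R) = (1 - p) ^+ n.
Proof.
elim: n => [|n IH] //=; rewrite IH (@eq_binE _ p n _ (fun=> 0)) ?binE_cst//.
by rewrite exprS; lra.
Qed.

(** The first observation equals [j] with probability [mu j] and then raises the count by one; this
    is the recursion that defines [binE]. *)
Lemma mean_occ (R : realType) (mu : nat -> R) m j (h : nat -> R) :
  is_weight mu -> (forall k, 0 <= h k) ->
  mean (@prod_mass R m mu) (fun x => (h (occ x j))%:E) = (binE (mu j) m h)%:E.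
Proof.
move=> muP; elim: m h => [|m IH] h h0.
  rewrite (mean_prod_mass0 mu (fun=> 0%N)) => [|y]; last by rewrite lee_fin.
  by rewrite /occ big_ord0.
have mu01 : 0 <= mu j <= 1 by rewrite weight_le1// muP.1.
rewrite mean_prod_massS => [|//|x]; last by rewrite lee_fin.
transitivity (mean mu (fun i =>
    (if i == j then binE (mu j) m (h \o succn) else binE (mu j) m h)%:E)); last first.
  by rewrite mean_if_eq ?binE_ge0// => k; apply: h0.
apply: eq_mean => i; case: eqP => [->|/eqP ij].
  rewrite -IH; last by move=> k; apply: h0.
  by apply: eq_mean => x; rewrite occ_cons eqxx.
by rewrite -IH//; apply: eq_mean => x; rewrite occ_cons (negbTE ij).
Qed.

(* For a mean at most 1 the deviation is carried by the event [k = 0];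
   otherwise both sides are compared with a quadratic polynomial of [k]. *)
Lemma binE_dev (R : realType) (p : R) n :
  0 <= p <= 1 ->
  binE p n (fun k => `|k%:R - n%:R * p|) <= 2 * binE p n (fun k => Num.sqrt k%:R).
Proof.
move=> p01; have /andP[p0 p1] := p01; set l := n%:R * p.
have l0 : 0 <= l by rewrite mulr_ge0.
rewrite -binEZ; have [l1|l1] := leP l 1.
  have dev : binE p n (fun k => `|k%:R - l|) = 2 * l * (1 - p) ^+ n.
    rewrite (@eq_binE _ p n _ (fun k => k%:R + (- l + (2 * l) * (k == 0%N)%:R))).
      by rewrite !binED binEZ binE_cst binE_id binE_eq0 -/l; lra.
    case=> [|k] /=; first by rewrite sub0r normrN ger0_norm//; lra.
    rewrite ger0_norm; first by lra.
    by rewrite subr_ge0 (le_trans l1)// ler1n.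
  (* The root of a natural number is at least the indicator of [k != 0]. *)
  have sq : 2 * (1 - (1 - p) ^+ n) <= binE p n (fun k => 2 * Num.sqrt k%:R).
    rewrite binEZ ler_pM2l// -binE_eq0 -[X in X - _](binE_cst p n 1).
    rewrite -[X in _ - X]mul1r -mulNr -binEZ -binED.
    apply: le_binE => // -[|k] /=; first by rewrite sqrtr0; lra.
    by rewrite mulr0 addr0 -[leLHS]sqrtr1 ler_sqrt// ler1n.
  (* Bernoulli's inequality gives [(1 + l) * (1 - p) ^+ n <= (1 - p ^+ 2) ^+ n <= 1], that is
     [l * (1 - p) ^+ n <= 1 - (1 - p) ^+ n], which joins [dev] to [sq]. *)
  have bern : 1 + l <= (1 + p) ^+ n.
    rewrite /l; elim: n {l l0 l1 dev sq} => [|n IH]; first by rewrite mul0r addr0 expr0.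
    rewrite exprS -natr1; apply: le_trans (ler_wpM2l _ IH); last by lra.
    have : 0 <= n%:R * p * p by rewrite !mulr_ge0.
    lra.
  have q0 : 0 <= (1 - p) ^+ n by rewrite exprn_ge0// subr_ge0.
  have : (1 + l) * (1 - p) ^+ n <= 1.
    apply: (@le_trans _ _ ((1 + p) ^+ n * (1 - p) ^+ n)); first exact: ler_wpM2r.
    rewrite -exprMn exprn_ile1//; first by rewrite mulr_ge0 ?subr_ge0//; lra.
    have : 0 <= p * p by rewrite mulr_ge0.
    lra.
  rewrite dev; lra.
set r := Num.sqrt l.
have rl : r ^+ 2 = l by rewrite sqr_sqrtr.
have r1 : 1 <= r by rewrite -sqrtr1 ler_sqrt ?ltW// (lt_trans ltr01).
have r0 : 0 < r by lra.
(* [A], [B], [D] are the coefficients in [k] of [(k - l) ^+ 2 / (2 * r) + r / 2], which dominates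
   the deviation, plus [k ^+ 2 / r ^+ 3 - 3 * k / r], which is at least [- 2 * Num.sqrt k]. Both
   bounds are tangent at [s = r] for the root [s] of [k]: the second is [cub]. *)
pose A := (2 * r)^-1 + r ^- 3.
pose B := - (r + 3 / r).
pose D := r ^+ 3 / 2 + r / 2.
have pt k : `|k%:R - l| <= 2 * Num.sqrt k%:R + (A * k%:R ^+ 2 + (B * k%:R + D)).
  set s := Num.sqrt k%:R; have s0 : 0 <= s by exact: sqrtr_ge0.
  have -> : k%:R = s ^+ 2 :> R by rewrite sqr_sqrtr.
  set N := s ^+ 2.
  have amgm : `|N - l| <= (N - l) ^+ 2 / (2 * r) + r / 2.
    rewrite -real_normK ?num_real//; set z := `|N - l|; rewrite -subr_ge0.
    have -> : z ^+ 2 / (2 * r) + r / 2 - z = (z - r) ^+ 2 / (2 * r) by field; lra.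
    by rewrite divr_ge0 ?sqr_ge0//; lra.
  have cub : 0 <= s * ((s / r - 1) ^+ 2 * (s / r + 2)).
    by apply: mulr_ge0 => //; apply: mulr_ge0; rewrite ?sqr_ge0 ?addr_ge0 ?divr_ge0// ltW.
  apply: le_trans amgm _; rewrite -subr_ge0; apply: le_trans cub _.
  rewrite le_eqVlt; apply/orP; left; apply/eqP; rewrite /A /B /D /N -rl; field.
  lra.
apply: (le_trans (le_binE n p01 pt)).
(* Only the mean of the quadratic has to be nonpositive. Bounding the variance [l * (1 - p)] by [l]
   turns it into [r^-1 - r], and [r >= 1]. *)
rewrite binED gerDl !binED !binEZ binE_cst binE_id binE_sqr -/l.
have lA : A * (l ^+ 2 + l * (1 - p)) <= A * (l ^+ 2 + l).
  rewrite ler_wpM2l ?addr_ge0 ?invr_ge0 ?exprn_ge0//; try lra.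
  have : 0 <= l * p by rewrite mulr_ge0.
  lra.
apply: (@le_trans _ _ (r^-1 - r)); last by rewrite subr_le0 (@le_trans _ _ 1)// invf_le1.
have -> : r^-1 - r = A * (l ^+ 2 + l) + (B * l + D) by rewrite /A /B /D -rl; field; lra.
by rewrite -/D lerD2r.
Qed.

(** * Range of [tv] and [Phi] on samples, and their change under one observation *)

Lemma esum_pred1 (R : realType) (T : choiceType) (a : T) :
  \esum_(j in [set: T]) ((a == j)%:R%:E : \bar R) = 1%E.
Proof.
rewrite -(@esum_set1 R _ a (fun=> 1%E)) ?lee_fin// [RHS]esum_mkcond.
apply: eq_esum => j _; have [->|aj] := eqVneq a j; first by rewrite mem_set.
by rewrite memNset// => /eqP; rewrite eq_sym (negbTE aj).
Qed.

Lemma esum_occ (R : realType) m (x : 'I_m -> nat) :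
  \esum_(j in [set: nat]) ((occ x j)%:R%:E : \bar R) = m%:R%:E.
Proof.
transitivity (\esum_(j in [set: nat]) \sum_(t < m) ((x t == j)%:R%:E : \bar R))%E.
  by apply: eq_esum => j _; rewrite sumEFin /occ natr_sum.
rewrite esum_sum; last by move=> j t _ _; rewrite lee_fin ler0n.
under eq_bigr do rewrite esum_pred1.
by rewrite sumEFin sumr_const card_ord.
Qed.

Lemma empE (R : realType) m (x : 'I_m -> nat) j :
  emp x j = m%:R^-1 * (occ x j)%:R :> R.
Proof. by rewrite /emp /occ natr_sum mulrC. Qed.

Lemma is_weight_emp (R : realType) m (x : 'I_m -> nat) :
  (0 < m)%N -> is_weight (emp x : nat -> R).
Proof.
move=> m0; split => [j|]; first by rewrite empE mulr_ge0 ?invr_ge0.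
under eq_esum do rewrite empE EFinM.
rewrite esumZl ?invr_ge0//.
by rewrite esum_occ -EFinM mulVf// pnatr_eq0 -lt0n.
Qed.

Lemma tvE (R : realType) (mu nu : nat -> R) :
  tv mu nu = \esum_(i in [set: nat]) (2^-1 * `|mu i - nu i|)%:E.
Proof.
by rewrite /tv -esumZl ?invr_ge0.
Qed.

Lemma PhiE (R : realType) m (x : 'I_m -> nat) :
  Phi m (emp x : nat -> R) =
  \esum_(j in [set: nat]) (m%:R^-1 * Num.sqrt (occ x j)%:R)%:E.
Proof.
rewrite /Phi -esumZl ?invr_ge0 ?sqrtr_ge0//.
apply: eq_esum => j _; rewrite empE sqrtrM ?invr_ge0// sqrtrV// -EFinM mulrA.
by rewrite -invfM -expr2 sqr_sqrtr.
Qed.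

Lemma tv_ge0 (R : realType) (mu nu : nat -> R) : (0 <= tv mu nu)%E.
Proof. by rewrite tvE; apply: esum_ge0 => i _; rewrite lee_fin mulr_ge0 ?invr_ge0. Qed.

Lemma tv_le1 (R : realType) (mu nu : nat -> R) :
  is_weight mu -> is_weight nu -> (tv mu nu <= 1)%E.
Proof.
move=> [mu0 mu1] [nu0 nu1].
have -> : (1 = (2^-1)%:E * \esum_(i in [set: nat]) ((mu i)%:E + (nu i)%:E) :> \bar R)%E.
  rewrite esumD => [|i _|i _]; rewrite ?lee_fin// mu1 nu1 -EFinD -EFinM.
  by congr EFin; lra.
rewrite lee_wpmul2l ?lee_fin ?invr_ge0//; apply: le_esum => i _.
by rewrite -EFinD lee_fin (le_trans (ler_normB _ _))// !ger0_norm.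
Qed.

Lemma Phi_ge0 (R : realType) m (nu : nat -> R) : (0 <= Phi m nu)%E.
Proof.
rewrite mule_ge0 ?lee_fin ?invr_ge0 ?sqrtr_ge0//.
by apply: esum_ge0 => j _; rewrite lee_fin sqrtr_ge0.
Qed.

(** Compare squares, using [l <= l ^+ 2] for a natural number. The case [k = 0] gives [Phi <= 1],
    and [l <= 1] gives the sensitivity of [Phi]. *)
Lemma sqrtr_nat_le (R : realType) (k l : nat) :
  Num.sqrt (k + l)%:R <= Num.sqrt k%:R + l%:R :> R.
Proof.
have s0 := sqrtr_ge0 (k%:R : R).
have l0 : (0 : R) <= l%:R by [].
rewrite -[leRHS]ger0_norm ?addr_ge0// -sqrtr_sqr ler_sqrt ?sqr_ge0//.
rewrite sqrrD sqr_sqrtr// natrD.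
have ll : (l%:R : R) <= l%:R ^+ 2.
  by rewrite -natrX ler_nat; case: l {l0} => // l; rewrite -mulnn leq_pmulr.
have : 0 <= Num.sqrt k%:R * l%:R :> R by rewrite mulr_ge0.
lra.
Qed.

Lemma Phi_emp_le1 (R : realType) m (x : 'I_m -> nat) :
  (0 < m)%N -> (Phi m (emp x : nat -> R) <= 1)%E.
Proof.
move=> m0; rewrite PhiE.
have -> : (1 = (m%:R^-1)%:E * \esum_(j in [set: nat]) (occ x j)%:R%:E :> \bar R)%E.
  by rewrite esum_occ -EFinM mulVf// pnatr_eq0 -lt0n.
rewrite -esumZl ?invr_ge0//.
apply: le_esum => j _; rewrite -EFinM lee_fin ler_wpM2l ?invr_ge0//.
by have := sqrtr_nat_le R 0 (occ x j); rewrite add0n sqrtr0 add0r.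
Qed.

(** Written with sums on both sides because subtraction on [nat] truncates. *)
Lemma occ_change m (x y : 'I_m -> nat) k j :
  (forall t, t != k -> x t = y t) ->
  (occ x j + (y k == j) = occ y j + (x k == j))%N.
Proof.
move=> xy; rewrite /occ (bigD1 k)//= [in RHS](bigD1 k)//=.
rewrite (eq_bigr (fun t => y t == j : nat)) => [|t tk]; last by rewrite xy.
by rewrite addnC addnA [RHS]addnAC.
Qed.

Lemma tv_emp_change (R : realType) m (mu : nat -> R) (x y : 'I_m -> nat) k :
  (0 < m)%N -> (forall t, t != k -> x t = y t) ->
  (tv (emp x) mu <= tv (emp y) mu + (m%:R^-1)%:E)%E.
Proof.
move=> m0 xy; rewrite !tvE.
have mV0 : 0 <= m%:R^-1 :> R by rewrite invr_ge0.
have ind0 (z : nat) j : (0 <= (z == j)%:R%:E :> \bar R)%E by rewrite lee_fin ler0n.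
(* The allowance [1 / m] is spread over the two atoms whose counts may change, half on each, so that
   the sums compare term by term. *)
have -> : ((m%:R^-1)%:E = \esum_(j in [set: nat])
    ((2^-1 * m%:R^-1)%:E * ((x k == j)%:R%:E + (y k == j)%:R%:E)) :> \bar R)%E.
  rewrite esumZl ?mulr_ge0 ?invr_ge0// => [|j]; last by rewrite adde_ge0.
  by rewrite esumD// !esum_pred1 -EFinD -EFinM; congr EFin; lra.
rewrite -esumD; last 2 first.
- by move=> j _; rewrite lee_fin mulr_ge0 ?invr_ge0.
- by move=> j _; rewrite mule_ge0 ?adde_ge0// lee_fin mulr_ge0 ?invr_ge0.
apply: le_esum => j _; rewrite -(EFinD (x k == j)%:R) -EFinM -EFinD lee_fin -mulrA -mulrDr.
rewrite ler_wpM2l ?invr_ge0//.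
have /(congr1 (fun n => n%:R : R)) := occ_change j xy; rewrite !natrD => e.
have -> : emp x j - mu j = (emp y j - mu j) + m%:R^-1 * ((x k == j)%:R - (y k == j)%:R).
  rewrite !empE (_ : (occ x j)%:R = (occ y j)%:R + ((x k == j)%:R - (y k == j)%:R) :> R); lra.
rewrite (le_trans (ler_normD _ _))// lerD2l normrM ger0_norm// ler_wpM2l//.
by rewrite (le_trans (ler_normB _ _))// !ger0_norm ?ler0n.
Qed.

Lemma Phi_emp_change (R : realType) m (x y : 'I_m -> nat) k :
  (0 < m)%N -> (forall t, t != k -> x t = y t) ->
  (Phi m (emp x : nat -> R) <= Phi m (emp y) + (m%:R^-1)%:E)%E.
Proof.
move=> m0 xy; rewrite !PhiE.
have mV0 : 0 <= m%:R^-1 :> R by rewrite invr_ge0.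
have ind0 (z : nat) j : (0 <= (z == j)%:R%:E :> \bar R)%E by rewrite lee_fin ler0n.
(* The whole allowance goes to the atom [x k], the only one that can be more frequent in [x] than in
   [y]. *)
have -> : ((m%:R^-1)%:E = \esum_(j in [set: nat])
    ((m%:R^-1)%:E * (x k == j)%:R%:E) :> \bar R)%E.
  by rewrite esumZl// esum_pred1 mule1.
rewrite -esumD; last 2 first.
- by move=> j _; rewrite lee_fin mulr_ge0 ?sqrtr_ge0.
- by move=> j _; rewrite mule_ge0.
apply: le_esum => j _; rewrite -EFinM -EFinD lee_fin -mulrDr ler_wpM2l//.
apply: le_trans (sqrtr_nat_le _ _ _).
by rewrite -(occ_change j xy) ler_sqrt ?ler0n// ler_nat leq_addr.
Qed.

(** * The inequality in expectation *)

Lemma mean_tv_le_mean_Phi (R : realType) m (mu : nat -> R) :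
  (0 < m)%N -> is_weight mu ->
  (mean (@prod_mass R m mu) (fun x => tv (emp x) mu) <=
   mean (@prod_mass R m mu) (fun x => Phi m (emp x)))%E.
Proof.
move=> m0 muP; have wP := is_weight_prod_mass m muP.
have m1 : 0 < m%:R :> R by rewrite ltr0n.
have mV0 : 0 <= m%:R^-1 :> R by rewrite invr_ge0.
rewrite (eq_mean _ (fun x => tvE (emp x) mu)) (eq_mean _ (fun x => PhiE R x)).
have tv0 x j : (0 <= (2^-1 * `|@emp R m x j - mu j|)%:E)%E.
  by rewrite lee_fin mulr_ge0 ?invr_ge0.
have Phi0 (x : 'I_m -> nat) j : (0 <= (m%:R^-1 * Num.sqrt (occ x j)%:R : R)%:E)%E.
  by rewrite lee_fin mulr_ge0 ?sqrtr_ge0.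
rewrite !mean_esum//.
apply: le_esum => j _.
(* For a fixed atom both terms depend on the sample through its count alone. The factor [1 / 2] of
   [tv] absorbs the constant 2 of [binE_dev]. *)
pose h k : R := (2^-1 * m%:R^-1) * `|k%:R - m%:R * mu j|.
rewrite (@eq_mean _ _ _ _ (fun x => (h (occ x j))%:E)); last first.
  move=> x; congr EFin; rewrite /h -mulrA; congr (_ * _).
  rewrite empE -[X in X * `|_|]ger0_norm// -normrM mulrBr mulKf ?lt0r_neq0//.
pose g k : R := m%:R^-1 * Num.sqrt k%:R.
rewrite [leRHS](@eq_mean _ _ _ _ (fun x => (g (occ x j))%:E))//.
rewrite !mean_occ//; last 2 first.
- by move=> k; rewrite mulr_ge0 ?sqrtr_ge0.
- by move=> k; rewrite !mulr_ge0 ?invr_ge0.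
rewrite lee_fin !binEZ.
have mu01 : 0 <= mu j <= 1 by rewrite weight_le1// muP.1.
rewrite [2^-1 * _]mulrC -mulrA ler_wpM2l// mulrC ler_pdivrMr// [leRHS]mulrC.
exact: binE_dev.
Qed.

(** * The deviation inequality *)

(** [g] dominates the indicator of the complement of [A], whose mass is therefore at most [e]. *)
Lemma markov_compl (R : realType) (T : choiceType) (w : T -> R) (A : set T)
    (g : T -> R) (e : R) :
  is_weight w -> (forall x, 0 <= g x) -> (forall x, ~ A x -> 1 <= g x) ->
  (mean w (EFin \o g) <= e%:E)%E ->
  ((1 - e)%:E <= \esum_(x in A) (w x)%:E)%E.
Proof.
move=> [w0 w1] g0 gA ge.
have : (\esum_(x in ~` A) (w x)%:E <= e%:E)%E.
  apply: le_trans ge; rewrite esum_mkcond; apply: le_esum => x _.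
  case: ifPn => [|_]; last by rewrite -EFinM lee_fin mulr_ge0.
  by rewrite inE => /gA g1; rewrite -EFinM lee_fin ler_peMr.
move: w1; rewrite (esumID A) ?setTI => [w1 le_e|x _]; last by rewrite lee_fin.
by rewrite EFinB leeBlDr// -w1 leeD2l.
Qed.

Lemma prob_tv_le_Phi (R : realType) m (delta : R) (mu : nat -> R) :
  (0 < m)%N -> 0 < delta < 1 -> is_weight mu ->
  ((1 - delta)%:E <= \esum_(x in [set x : 'I_m -> nat |
       (tv (emp x) mu <= Phi m (emp x)
          + (3 * Num.sqrt (ln (2 / delta) / (2 * m%:R)))%:E)%E])
     (prod_mass mu x)%:E)%E.
Proof.
move=> m0 /andP[d0 d1] muP; have wP := is_weight_prod_mass m muP.
have m1 : 0 < m%:R :> R by rewrite ltr0n.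
set t := Num.sqrt _.
have t0 : 0 <= t by exact: sqrtr_ge0.
have ln0 : 0 <= ln (2 / delta).
  by rewrite ln_ge0// ler_pdivlMr//; lra.
have t2 : m%:R * t ^+ 2 = ln (2 / delta) / 2.
  by rewrite /t sqr_sqrtr ?divr_ge0// ?mulr_ge0//; field; lra.
have tv1 (x : 'I_m -> nat) := tv_le1 (is_weight_emp R x m0) muP.
have Phi1 (x : 'I_m -> nat) := Phi_emp_le1 R x m0.
have tvfin (x : 'I_m -> nat) : tv (emp x) mu \is a fin_num.
  by rewrite ge0_fin_numE ?tv_ge0// (le_lt_trans (tv1 x))// ltry.
have Phifin (x : 'I_m -> nat) : Phi m (emp x : nat -> R) \is a fin_num.
  by rewrite ge0_fin_numE ?Phi_ge0// (le_lt_trans (Phi1 x))// ltry.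
have [t3|t3] := leP (1 / 3) t.
  apply: (@markov_compl _ _ _ _ (fun=> 0)) => // [x []|].
    apply: (le_trans (tv1 x)); rewrite -[X in (X <= _)%E]add0e leeD ?Phi_ge0//.
    by rewrite lee_fin; lra.
  by rewrite [X in (X <= _)%E]mean_cst// lee_fin ltW.
pose u (x : 'I_m -> nat) := fine (tv (emp x) mu).
pose v (x : 'I_m -> nat) := fine (Phi m (emp x : nat -> R)).
have u01 x : 0 <= u x <= 1 by rewrite fine_ge0 ?tv_ge0//= -lee_fin fineK.
have v01 x : 0 <= v x <= 1 by rewrite fine_ge0 ?Phi_ge0//= -lee_fin fineK.
(* With this scale the differences of [F], at most [a * (2 / m)], are at most [2 * t], which stays
   below the threshold [2 / 3] of [mean_expR_le]. The [+ 1] in [F] keeps it nonnegative, since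
   [v <= 1]. *)
pose a := t * m%:R; have a0 : 0 <= a by rewrite mulr_ge0.
pose F x := a * (u x + 1 - v x).
have F0 x : 0 <= F x.
  by rewrite mulr_ge0//; have /andP[? ?] := u01 x; have /andP[? ?] := v01 x; lra.
have FC x : 0 <= F x <= a * 2.
  rewrite F0/= ler_wpM2l//.
  by have /andP[? ?] := u01 x; have /andP[? ?] := v01 x; lra.
have Fdiff k x y : (forall s, s != k -> x s = y s) -> F x - F y <= 2 * t.
  move=> xy; rewrite /F -mulrBr.
  have : u x <= u y + m%:R^-1.
    by rewrite -lee_fin EFinD !fineK//; exact: tv_emp_change xy.
  have : v y <= v x + m%:R^-1.
    rewrite -lee_fin EFinD !fineK//; apply: (@Phi_emp_change _ _ _ _ k) => // s sk.
    by rewrite xy.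
  move=> vyx uxy; apply: (@le_trans _ _ (a * (2 * m%:R^-1))).
    by rewrite ler_wpM2l//; lra.
  by rewrite /a le_eqVlt; apply/orP; left; apply/eqP; field; lra.
have t23 : 2 * t <= 2 / 3 by lra.
have [Ffin _] := mean_bounded wP (lexx 0) FC.
have [vfin _] := mean_bounded wP (lexx 0) v01.
have meanF : fine (mean (prod_mass mu) (EFin \o F)) <= a.
  (* Moving the mean of [v] to the left makes every mean that of a nonnegative function. *)
  have Fv : (mean (prod_mass mu) (EFin \o F) + a%:E * mean (prod_mass mu) (EFin \o v) =
      a%:E * mean (prod_mass mu) (EFin \o u) + a%:E)%E.
    have v0 x : (0 <= (v x)%:E)%E by rewrite lee_fin; case/andP: (v01 x).
    have u0 x : (0 <= (u x)%:E)%E by rewrite lee_fin; case/andP: (u01 x).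
    have av0 x : (0 <= a%:E * (v x)%:E)%E by rewrite mule_ge0// lee_fin.
    have au0 x : (0 <= a%:E * (u x)%:E)%E by rewrite mule_ge0// lee_fin.
    rewrite -[X in (_ = _ + X)%E](mean_cst wP a0) -!meanZl// -!meanD//.
    by apply: eq_mean => x /=; rewrite -!EFinM -!EFinD /F; congr EFin; lra.
  have uv : (mean (prod_mass mu) (EFin \o u) <= mean (prod_mass mu) (EFin \o v))%E.
    have := mean_tv_le_mean_Phi m0 muP.
    rewrite (@eq_mean _ _ _ (fun x => tv _ _) (EFin \o u)) => [|x]; last by rewrite /= fineK.
    by rewrite (@eq_mean _ _ _ (fun x => Phi _ _) (EFin \o v)) => [|x]; last by rewrite /= fineK.
  have : (mean (prod_mass mu) (EFin \o F) + a%:E * mean (prod_mass mu) (EFin \o v) <=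
      a%:E * mean (prod_mass mu) (EFin \o v) + a%:E)%E.
    by rewrite Fv leeD2r// lee_wpmul2l// lee_fin.
  by rewrite -(fineK vfin) -(fineK Ffin) -EFinM -!EFinD !lee_fin; lra.
(* The value of [F] when [u = v + 3 * t]: on the bad event [F] exceeds [s]. *)
pose s := a * (1 + 3 * t).
apply: (@markov_compl _ _ _ _ (fun x => expR (- s) * expR (F x))) => // [x|].
- move=> /negP; rewrite -ltNge -(fineK (tvfin x)) -(fineK (Phifin x)) -EFinD lte_fin.
  rewrite -/(u x) -/(v x) => bad; rewrite -expRD -expR0 ler_expR /s /F.
  rewrite addrC -mulrBr mulr_ge0//; lra.
- rewrite (@eq_mean _ _ _ _ (fun x => (expR (- s))%:E * (expR (F x))%:E)%E)//.
  rewrite meanZl ?expR_ge0//.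
  apply: (le_trans (lee_wpmul2l _ (mean_expR_bounded_diff muP t23 FC Fdiff))).
    by rewrite lee_fin expR_ge0.
  rewrite -EFinM -expRD lee_fin.
  (* The exponent is at most [- s + a + m * t ^+ 2 = - 2 * m * t ^+ 2 = - ln (2 / delta)], so the
     bad event has mass at most [delta / 2]. *)
  apply: (@le_trans _ _ (expR (- ln (2 / delta)))).
    rewrite ler_expR /s /a.
    have -> : m%:R * ((2 * t) ^+ 2 / 4) = m%:R * t ^+ 2 by field.
    have -> : t * m%:R * (1 + 3 * t) = a + 3 * (m%:R * t ^+ 2) by rewrite /a; ring.
    rewrite t2; lra.
  rewrite expRN lnK ?posrE ?divr_gt0// invf_div; lra.
Qed.

Theorem theorem1 (R : realType) (m : nat) (delta : R) (mu : nat -> R) :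
  (0 < m)%N -> 0 < delta < 1 -> is_distr mu ->
  ((1 - delta)%:E <=
     Prob mu [set x : 'I_m -> nat |
       (tv (emp x) mu <= Phi m (emp x)
          + (3 * Num.sqrt (ln (2 / delta) / (2 * m%:R)))%:E)%E])%E
  /\
  (Expect mu (fun x : 'I_m -> nat => tv (emp x) mu)
     <= Expect mu (fun x : 'I_m -> nat => Phi m (emp x)))%E.
Proof.
move=> m0 d01 muP; split; first exact: prob_tv_le_Phi.
exact: mean_tv_le_mean_Phi.
Qed.
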